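(* Let $T$ be an anti-super-$\mathcal O$-operator on a Hom-Lie superalgebra $(\mathfrak g,[\cdot,\cdot],\alpha)$ with respect to a representation $(V,\rho,\beta)$, and define $\circ_V:V\times V\to V$ by $u\circ_V v=-\rho(T(u))v$. Then $(V,\circ_V,\beta)$ satisfies, for all homogeneous $u,v,w\in V$, $$\beta(u)\circ_V(v\circ_V w)-(-1)^{|u||v|}\beta(v)\circ_V(u\circ_V w)=(-1)^{|u||v|}[v,u]_{\circ_V}\circ_V\beta(w),$$ where $[u,v]_{\circ_V}=u\circ_V v-(-1)^{|u||v|}v\circ_V u$. Moreover, $(V,\circ_V,\beta)$ is a Hom-Lie-admissible superalgebra such that $(V,\circ_V,\beta)$ is a Hom-anti-pre-Lie superalgebra if and only if $T$ is strong. In this case, $T$ is a homomorphism of Hom-Lie superalgebras from the sub-adjacent Hom-Lie superalgebra $(\mathfrak g(V),[\cdot,\cdot]_{\circ_V},\beta)$ to $(\mathfrak g,[\cdot,\cdot],\alpha)$; furthermore, there is an induced Hom-anti-pre-Lie superalgebra structure on $T(V)=\{T(u):u\in V\}\subset\mathfrak g$ (with twisting map the restriction of $\alpha$) given by $$T(u)\circ_{\mathfrak g}T(v)=T(u\circ_V v),\qquad u,v\in V,$$ and $T$ is a homomorphism of Hom-anti-pre-Lie superalgebras.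
   Context: All vector spaces are finite-dimensional over a field $\mathbb F$ of characteristic $0$ and $\mathbb Z_2$-graded; $|x|$ is the degree of a homogeneous element; identities are required for homogeneous elements. A Hom-Lie superalgebra is $(\mathfrak g,[\cdot,\cdot],\alpha)$ with $[\cdot,\cdot]$ even bilinear, $\alpha$ even linear, $[x,y]=-(-1)^{|x||y|}[y,x]$ and $[\alpha(x),[y,z]]=[[x,y],\alpha(z)]+(-1)^{|x||y|}[\alpha(y),[x,z]]$. A representation of it is $(V,\rho,\beta)$ with $\beta:V\to V$ even linear, $\rho:\mathfrak g\to\mathrm{End}(V)$ even linear, $\rho(\alpha(x))\beta=\beta\rho(x)$ and $\rho([x,y])\beta=\rho(\alpha(x))\rho(y)-(-1)^{|x||y|}\rho(\alpha(y))\rho(x)$. An anti-super-$\mathcal O$-operator associated to $(V,\rho,\beta)$ is an even linear map $T:V\to\mathfrak g$ with $T\circ\beta=\alpha\circ T$ and $[T(u),T(v)]=T\big((-1)^{|u||v|}\rho(T(v))u-\rho(T(u))v\big)$. It is strong if for all $u,v,w\in V$: $\rho([T(u),T(v)])\beta(w)+(-1)^{|u|(|v|+|w|)}\rho([T(v),T(w)])\beta(u)+(-1)^{|w|(|u|+|v|)}\rho([T(w),T(u)])\beta(v)=0$. A Hom-anti-pre-Lie superalgebra is $(\mathcal A,\circ,\alpha)$ with $\circ$ even bilinear, $\alpha$ even linear such that, with $[x,y]_\circ=x\circ y-(-1)^{|x||y|}y\circ x$: $\alpha(x)\circ(y\circ z)-(-1)^{|x||y|}\alpha(y)\circ(x\circ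 z)=(-1)^{|x||y|}[y,x]_\circ\circ\alpha(z)$ and $(-1)^{|x||z|}[x,y]_\circ\circ\alpha(z)+(-1)^{|x||y|}[y,z]_\circ\circ\alpha(x)+(-1)^{|y||z|}[z,x]_\circ\circ\alpha(y)=0$. $(\mathcal A,\circ,\alpha)$ is Hom-Lie-admissible if $(\mathcal A,[\cdot,\cdot]_\circ,\alpha)$ is a Hom-Lie superalgebra, then called the sub-adjacent Hom-Lie superalgebra $\mathfrak g(\mathcal A)$. Homomorphisms are even linear maps preserving products and intertwining twisting maps. *)

(* Defs.v *)
From HB Require Import structures.
From mathcomp Require Import all_boot all_order all_algebra.

Set Implicit Arguments.
Unset Strict Implicit.
Unset Printing Implicit Defensive.

Import GRing.Theory.
Local Open Scope ring_scope.

(* A superspace is a finite-dimensional space W with a family gr of subspaces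
   indexed by 'Z_2.  "x is homogeneous of degree i" reads x \in gr i.  In signs
   such as (-1) ^+ (i * j) the exponent is computed in nat, from the
   representatives 0 and 1 of the degrees; in gr (i + j) the sum is in 'Z_2. *)

Definition is_grading (F : fieldType) (W : vectType F)
    (gr : 'Z_2 -> {vspace W}) : Prop :=
  directv (\sum_i gr i) /\ (\sum_i gr i)%VS = fullv.

Definition even_map (F : fieldType) (U W : vectType F)
    (grU : 'Z_2 -> {vspace U}) (grW : 'Z_2 -> {vspace W})
    (f : 'Hom(U, W)) : Prop :=
  forall i x, x \in grU i -> f x \in grW i.

Definition even_bilinear (F : fieldType) (W : vectType F)
    (gr : 'Z_2 -> {vspace W}) (mul : W -> W -> W) : Prop :=
  bilinear_for *:%R *:%R mul /\
  forall i j x y, x \in gr i -> y \in gr j -> mul x y \in gr (i + j).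

(* The component of degree i: projection onto gr i along the other summand. *)
Definition component (F : fieldType) (W : vectType F)
    (gr : 'Z_2 -> {vspace W}) (i : 'Z_2) : 'End(W) :=
  daddv_pi (gr i) (gr (i + 1)).

(* x o y - (-1)^(|x||y|) y o x makes sense only for homogeneous x and y; this is
   its bilinear extension to all of W (see supercommE). *)
Definition supercomm (F : fieldType) (W : vectType F)
    (gr : 'Z_2 -> {vspace W}) (mul : W -> W -> W) (x y : W) : W :=
  \sum_(i : 'Z_2) \sum_(j : 'Z_2)
    (mul (component gr i x) (component gr j y)
     - (-1) ^+ (i * j) *: mul (component gr j y) (component gr i x)).

Record hom_lie_superalgebra (F : fieldType) (g : vectType F)
    (gr : 'Z_2 -> {vspace g}) (br : g -> g -> g) (alpha : 'End(g)) : Prop :=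
  HomLieSuperalgebra {
    hl_grading : is_grading gr;
    hl_even_bilinear : even_bilinear gr br;
    hl_even_twist : even_map gr gr alpha;
    hl_skew : forall i j x y, x \in gr i -> y \in gr j ->
      br x y = - ((-1) ^+ (i * j) *: br y x);
    hl_jacobi : forall i j k x y z,
      x \in gr i -> y \in gr j -> z \in gr k ->
      br (alpha x) (br y z)
      = br (br x y) (alpha z) + (-1) ^+ (i * j) *: br (alpha y) (br x z)
  }.

Record hom_lie_representation (F : fieldType) (g : vectType F)
    (grg : 'Z_2 -> {vspace g}) (br : g -> g -> g) (alpha : 'End(g))
    (V : vectType F) (grV : 'Z_2 -> {vspace V})
    (rho : 'Hom(g, 'End(V))) (beta : 'End(V)) : Prop :=
  HomLieRepresentation {
    rep_grading : is_grading grV;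
    rep_even_twist : even_map grV grV beta;
    rep_even : forall i j x v, x \in grg i -> v \in grV j ->
      rho x v \in grV (i + j);
    rep_twist : forall i x, x \in grg i ->
      (rho (alpha x) \o beta)%VF = (beta \o rho x)%VF;
    rep_bracket : forall i j x y, x \in grg i -> y \in grg j ->
      (rho (br x y) \o beta)%VF
      = (rho (alpha x) \o rho y)%VF
        - (-1) ^+ (i * j) *: (rho (alpha y) \o rho x)%VF
  }.

Record anti_super_O_operator (F : fieldType) (g : vectType F)
    (grg : 'Z_2 -> {vspace g}) (br : g -> g -> g) (alpha : 'End(g))
    (V : vectType F) (grV : 'Z_2 -> {vspace V})
    (rho : 'Hom(g, 'End(V))) (beta : 'End(V)) (T : 'Hom(V, g)) : Prop :=
  AntiSuperOOperator {
    aso_even : even_map grV grg T;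
    aso_twist : (T \o beta)%VF = (alpha \o T)%VF;
    aso_bracket : forall i j u v, u \in grV i -> v \in grV j ->
      br (T u) (T v) = T ((-1) ^+ (i * j) *: rho (T v) u - rho (T u) v)
  }.

Definition strong (F : fieldType) (g : vectType F) (br : g -> g -> g)
    (V : vectType F) (grV : 'Z_2 -> {vspace V})
    (rho : 'Hom(g, 'End(V))) (beta : 'End(V)) (T : 'Hom(V, g)) : Prop :=
  forall i j k u v w, u \in grV i -> v \in grV j -> w \in grV k ->
    rho (br (T u) (T v)) (beta w)
    + (-1) ^+ (i * (j + k)) *: rho (br (T v) (T w)) (beta u)
    + (-1) ^+ (k * (i + j)) *: rho (br (T w) (T u)) (beta v) = 0.

Record hom_anti_pre_lie_superalgebra (F : fieldType) (A : vectType F)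
    (gr : 'Z_2 -> {vspace A}) (mul : A -> A -> A) (alpha : 'End(A)) : Prop :=
  HomAntiPreLieSuperalgebra {
    hapl_grading : is_grading gr;
    hapl_even_bilinear : even_bilinear gr mul;
    hapl_even_twist : even_map gr gr alpha;
    hapl_left : forall i j k x y z,
      x \in gr i -> y \in gr j -> z \in gr k ->
      mul (alpha x) (mul y z) - (-1) ^+ (i * j) *: mul (alpha y) (mul x z)
      = (-1) ^+ (i * j) *: mul (supercomm gr mul y x) (alpha z);
    hapl_cyclic : forall i j k x y z,
      x \in gr i -> y \in gr j -> z \in gr k ->
      (-1) ^+ (i * k) *: mul (supercomm gr mul x y) (alpha z)
      + (-1) ^+ (i * j) *: mul (supercomm gr mul y z) (alpha x)
      + (-1) ^+ (j * k) *: mul (supercomm gr mul z x) (alpha y) = 0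
  }.

Definition hom_lie_admissible (F : fieldType) (A : vectType F)
    (gr : 'Z_2 -> {vspace A}) (mul : A -> A -> A) (alpha : 'End(A)) : Prop :=
  hom_lie_superalgebra gr (supercomm gr mul) alpha.

Record superalgebra_hom (F : fieldType) (A B : vectType F)
    (grA : 'Z_2 -> {vspace A}) (mulA : A -> A -> A) (alphaA : 'End(A))
    (grB : 'Z_2 -> {vspace B}) (mulB : B -> B -> B) (alphaB : 'End(B))
    (f : 'Hom(A, B)) : Prop :=
  SuperalgebraHom {
    sh_even : even_map grA grB f;
    sh_mul : forall x y, f (mulA x y) = mulB (f x) (f y);
    sh_twist : (f \o alphaA)%VF = (alphaB \o f)%VF
  }.

(* The trace on a subspace U of the grading of W, U being seen as the type
   subvs_of U; it is a grading only when U is a graded subspace. *)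
Definition sub_grading (F : fieldType) (W : vectType F) (U : {vspace W})
    (gr : 'Z_2 -> {vspace W}) (i : 'Z_2) : {vspace subvs_of U} :=
  (linfun vsval @^-1: gr i)%VS.

(* T with its codomain restricted to T(V); see onto_imgE. *)
Definition onto_img (F : fieldType) (V g : vectType F) (T : 'Hom(V, g)) :
    'Hom(V, subvs_of (limg T)) :=
  (linfun (vsproj (limg T)) \o T)%VF.

Lemma onto_imgE (F : fieldType) (V g : vectType F) (T : 'Hom(V, g)) (u : V) :
  vsval (onto_img T u) = T u.
Proof. by rewrite comp_lfunE lfunE /= vsprojK // memv_img ?memvf. Qed.

Lemma sub_gradingE (F : fieldType) (W : vectType F) (U : {vspace W})
    (gr : 'Z_2 -> {vspace W}) (i : 'Z_2) (x : subvs_of U) :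
  (x \in sub_grading U gr i) = (vsval x \in gr i).
Proof. by rewrite /sub_grading -memv_preim lfunE. Qed.

Lemma Z2_cases (i : 'Z_2) : i = 0 \/ i = 1.
Proof. by case: i => [[|[|]]] // ?; [left|right]; apply: val_inj. Qed.

Lemma grading_cap0 (F : fieldType) (W : vectType F) (gr : 'Z_2 -> {vspace W})
    (i : 'Z_2) :
  is_grading gr -> (gr i :&: gr (i + 1)%R = 0)%VS.
Proof.
case=> dgr _; have /directv_sumP/(_ i isT) := dgr => gr0; apply/eqP.
rewrite -subv0 -[X in (_ <= X)%VS]gr0 capvS //.
apply: (sumv_sup (i + 1)) => //.
by case: (Z2_cases i) => ->.
Qed.

Lemma component_id (F : fieldType) (W : vectType F) (gr : 'Z_2 -> {vspace W})
    (i j : 'Z_2) (x : W) :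
  is_grading gr -> x \in gr i ->
  component gr j x = if j == i then x else 0.
Proof.
move=> Hgr xi; have [->|ji] := eqVneq j i.
  by rewrite /component daddv_pi_id ?grading_cap0.
have ij : i = j + 1.
  by case: (Z2_cases i) (Z2_cases j) ji => -> [] -> //= _; apply: val_inj.
have c0 := grading_cap0 j Hgr.
have xj : x \in gr (j + 1) by rewrite -ij.
have := daddv_pi_add c0 (subvP (addvSr _ _) _ xj).
rewrite [daddv_pi (gr (j + 1)) _ x]daddv_pi_id // 1?capvC //.
by rewrite -[RHS]add0r => /addIr.
Qed.

Lemma supercommE (F : fieldType) (W : vectType F) (gr : 'Z_2 -> {vspace W})
    (mul : W -> W -> W) (i j : 'Z_2) (x y : W) :
  is_grading gr -> bilinear_for *:%R *:%R mul -> x \in gr i -> y \in gr j ->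
  supercomm gr mul x y = mul x y - (-1) ^+ (i * j) *: mul y x.
Proof.
move=> Hgr [Hl Hr] xi yj.
have mul0l z : mul 0 z = 0.
  by have := Hl z (-1) 0 0; rewrite /= scaler0 addr0 scaleN1r addNr.
have mul0r z : mul z 0 = 0.
  by have := Hr z (-1) 0 0; rewrite /= scaler0 addr0 scaleN1r addNr.
rewrite /supercomm (bigD1 i) //= (bigD1 j) //= !(component_id _ Hgr xi).
rewrite !(component_id _ Hgr yj) !eqxx big1 => [|k /negbTE kj].
  rewrite addr0 big1 ?addr0 // => k /negbTE ki; rewrite big1 // => l _.
  by rewrite (component_id _ Hgr xi) ki mul0l mul0r scaler0 subr0.
by rewrite (component_id _ Hgr yj) kj mul0l mul0r scaler0 subr0.
Qed.

(* Main.v *)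
Require Import Defs.
From HB Require Import structures.
From mathcomp Require Import all_boot all_order all_algebra ring.

Set Implicit Arguments.
Unset Strict Implicit.
Unset Printing Implicit Defensive.

Import GRing.Theory.
Local Open Scope ring_scope.

(** The product u o v = - rho(T u) v turns statements about [T] and [rho] into
    statements about an algebra on V, through one identity: the operator
    equation for T says exactly that T sends the supercommutator of o to the
    bracket of g ([operator_supercomm]).

    - The left identity is then the compatibility of rho with the bracket,
      evaluated at the pair (T u, T v) ([operator_mul_left]).
    - The cyclic sum of the products [u, v] o beta(w) is, up to an overall
      sign, the cyclic sum in the definition of a strong operator
      ([operator_mul_cyclic]).  So o is Hom-anti-pre-Lie exactly when T is
      strong.
    - Admissibility comes for free: in any Hom-anti-pre-Lie superalgebra the
      left identity turns the Jacobi defect into twice the cyclic sum, which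
      vanishes ([hom_anti_pre_lie_admissible]).

    For the structure on T(V), the operator equation at v in ker T gives
    T (u o v) = 0, so that T(u o v) depends only on T u and T v
    ([operator_mul_lker]) and o descends to T(V).  All axioms then pass to T(V)
    because they are identities in homogeneous elements, and an even map sends
    homogeneous elements onto the homogeneous elements of its image
    ([hom_anti_pre_lie_surjective_image]).

    The signs enter only as scalars of square 1, bimultiplicative in the degrees
    ([superspace_sign_sqr], [superspace_signDr]). *)

(** * Bilinear maps and signs *)

(** Replaces a map that satisfies the bilinearity equations by a term of the
    structure type, to which the generic rewriting rules apply. *)
Lemma bilinear_structure (F : fieldType) (U V W : vectType F)
    (m : U -> V -> W) :
  bilinear_for *:%R *:%R m ->
  exists b : {bilinear U -> V -> W | *:%R & *:%R}, m = b :> (U -> V -> W).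
Proof.
move=> bm; pose b := bilinear_isBilinear.Build F U V W *:%R *:%R m bm.
pose m' : {bilinear U -> V -> W | *:%R & *:%R} := HB.pack m b.
by exists m'.
Qed.

(** Reduces an identity between vectors to identities between scalars, which a
    decision procedure for commutative rings can treat. *)
Lemma coord_ext (F : fieldType) (W : vectType F) (x y : W) :
  (forall n, coord (vbasis fullv) n x = coord (vbasis fullv) n y) -> x = y.
Proof.
move=> eq_xy; rewrite (coord_vbasis (memvf x)) (coord_vbasis (memvf y)).
by apply: eq_bigr => n _; rewrite eq_xy.
Qed.

Lemma superspace_signC (R : pzRingType) (i j : 'Z_2) :
  (-1) ^+ (i * j) = (-1) ^+ (j * i) :> R.
Proof. by rewrite mulnC. Qed.

(** The inner sum is taken modulo 2; only the parity of the exponent counts. *)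
Lemma superspace_signDr (R : pzRingType) (i j k : 'Z_2) :
  (-1) ^+ (i * (j + k)%R) = (-1) ^+ (i * j) * (-1) ^+ (i * k) :> R.
Proof.
case: (Z2_cases i) (Z2_cases j) (Z2_cases k) => -> [] -> [] ->;
  by rewrite /= ?expr0 ?expr1 ?mulr1 ?mul1r ?mulrNN ?mulr1.
Qed.

Lemma superspace_sign_sqr (R : pzRingType) (n : nat) :
  (-1) ^+ n * (-1) ^+ n = 1 :> R.
Proof. by rewrite -expr2 sqrr_sign. Qed.

(** * Gradings and even maps *)

Lemma component_mem (F : fieldType) (W : vectType F)
    (gr : 'Z_2 -> {vspace W}) (i : 'Z_2) (x : W) : component gr i x \in gr i.
Proof. exact: memv_pi. Qed.

Lemma sum_component (F : fieldType) (W : vectType F)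
    (gr : 'Z_2 -> {vspace W}) (x : W) :
  is_grading gr -> \sum_i component gr i x = x.
Proof.
move=> Hgr; have : x \in (\sum_i gr i)%VS by rewrite Hgr.2 memvf.
case/memv_sumP=> xs xsP ->; apply: eq_bigr => i _.
rewrite linear_sum (bigD1 i) //= (component_id _ Hgr (xsP i _)) // eqxx.
rewrite big1 ?addr0 // => j /negbTE ji.
by rewrite (component_id _ Hgr (xsP j _)) // eq_sym ji.
Qed.

(** The axioms only speak of homogeneous elements; this extends an equality of
    products to all elements, through their components. *)
Lemma bilinear_ext_homogeneous (F : fieldType) (U V W : vectType F)
    (grU : 'Z_2 -> {vspace U}) (grV : 'Z_2 -> {vspace V})
    (m1 m2 : U -> V -> W) :
  is_grading grU -> is_grading grV ->
  bilinear_for *:%R *:%R m1 -> bilinear_for *:%R *:%R m2 ->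
  (forall i j x y, x \in grU i -> y \in grV j -> m1 x y = m2 x y) ->
  forall x y, m1 x y = m2 x y.
Proof.
move=> HU HV /bilinear_structure[b1 ->] /bilinear_structure[b2 ->] eq_b x y.
rewrite -(sum_component x HU) -(sum_component y HV) !linear_sumlz.
apply: eq_bigr => i _; rewrite !linear_sumr; apply: eq_bigr => j _.
by apply: (eq_b i j); apply: component_mem.
Qed.

(** Both kernel and image of an even map are therefore graded subspaces, which
    is how this commutation is used below. *)
Lemma even_map_component (F : fieldType) (U W : vectType F)
    (grU : 'Z_2 -> {vspace U}) (grW : 'Z_2 -> {vspace W}) (f : 'Hom(U, W))
    (i : 'Z_2) (u : U) :
  is_grading grU -> is_grading grW -> even_map grU grW f ->
  component grW i (f u) = f (component grU i u).
Proof.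
move=> HU HW ev; have fc j : f (component grU j u) \in grW j.
  exact/ev/component_mem.
rewrite -{1}(sum_component u HU) linear_sum linear_sum (bigD1 i) //=.
rewrite (component_id _ HW (fc i)) eqxx big1 ?addr0 // => j /negbTE ji.
by rewrite (component_id _ HW (fc j)) eq_sym ji.
Qed.

(** Any preimage can be replaced by its component of degree [i]. *)
Lemma homogeneous_preimage (F : fieldType) (U W : vectType F)
    (grU : 'Z_2 -> {vspace U}) (grW : 'Z_2 -> {vspace W}) (f : 'Hom(U, W))
    (i : 'Z_2) (x : W) :
  is_grading grU -> is_grading grW -> even_map grU grW f ->
  x \in limg f -> x \in grW i -> exists2 u, u \in grU i & x = f u.
Proof.
move=> HU HW ev /memv_imgP[u _ ->] xi.
exists (component grU i u); first exact: component_mem.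
by rewrite -(even_map_component _ _ HU HW ev) (component_id _ HW xi) eqxx.
Qed.

(** Stability under the projections is what makes a subspace graded. *)
Lemma sub_grading_is_grading (F : fieldType) (W : vectType F)
    (gr : 'Z_2 -> {vspace W}) (U : {vspace W}) :
  is_grading gr -> (forall i x, x \in U -> component gr i x \in U) ->
  is_grading (sub_grading U gr).
Proof.
move=> Hgr stU; split.
  apply/directv_sum_independent => us usP us0 i _; apply: subvs_inj.
  have /directv_sum_independent/(_ (vsval \o us)) := Hgr.1; apply=> // [j _|].
    by rewrite /= -sub_gradingE usP.
  by rewrite -linear_sum us0.
apply/eqP; rewrite eqEsubv subvf; apply/subvP => x _; apply/memv_sumP.
have cK i : vsval (vsproj U (component gr i (vsval x))) =
    component gr i (vsval x) by rewrite vsprojK // stU ?subvsP.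
exists (fun i => vsproj U (component gr i (vsval x))) => [i _|].
  by rewrite sub_gradingE cK component_mem.
apply: subvs_inj; rewrite /= linear_sum -[LHS](sum_component _ Hgr).
by apply: eq_bigr => i _; exact: esym (cK i).
Qed.

(** * Supercommutators and Hom-anti-pre-Lie superalgebras *)

Lemma supercomm_bilinear (F : fieldType) (W : vectType F)
    (gr : 'Z_2 -> {vspace W}) (mul : W -> W -> W) :
  bilinear_for *:%R *:%R mul -> bilinear_for *:%R *:%R (supercomm gr mul).
Proof.
case/bilinear_structure=> m ->; split=> z a x y /=; rewrite /supercomm.
  rewrite scaler_sumr -big_split; apply: eq_bigr => i _.
  rewrite scaler_sumr -big_split; apply: eq_bigr => j _ /=.
  rewrite linearP linearPl linearPr scalerDr scalerBr !scalerA [_ * a]mulrC.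
  by rewrite opprD addrACA.
rewrite scaler_sumr -big_split; apply: eq_bigr => i _.
rewrite scaler_sumr -big_split; apply: eq_bigr => j _ /=.
rewrite linearP linearPl linearPr scalerDr scalerBr !scalerA [_ * a]mulrC.
by rewrite opprD addrACA.
Qed.

Lemma supercomm_even (F : fieldType) (W : vectType F)
    (gr : 'Z_2 -> {vspace W}) (mul : W -> W -> W) :
  is_grading gr -> even_bilinear gr mul -> even_bilinear gr (supercomm gr mul).
Proof.
move=> Hgr [bm ev]; split=> [|i j x y xi yj]; first exact: supercomm_bilinear.
rewrite (supercommE Hgr bm xi yj) rpredB ?rpredZ //; first exact: ev.
by rewrite addrC; apply: ev.
Qed.

Lemma supercomm_skew (F : fieldType) (W : vectType F)
    (gr : 'Z_2 -> {vspace W}) (mul : W -> W -> W) (i j : 'Z_2) (x y : W) :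
  is_grading gr -> bilinear_for *:%R *:%R mul -> x \in gr i -> y \in gr j ->
  supercomm gr mul x y = - ((-1) ^+ (i * j) *: supercomm gr mul y x).
Proof.
move=> Hgr bm xi yj.
rewrite (supercommE Hgr bm xi yj) (supercommE Hgr bm yj xi) superspace_signC.
by rewrite scalerBr scalerA superspace_sign_sqr scale1r opprB.
Qed.

(** Let a, b, c be the signs of the pairs (x, y), (x, z), (y, z).  Expanding
    the outer bracket of each Jacobi term into two products gives six products
    of the form alpha(_) o (_ o _); the left identity for (x, y), (x, z) and
    (y, z) turns them into products of the form [_, _] o alpha(_).  These are
    the same three products as the ones left by the expansion, with the same
    signs, so that the Jacobi defect is
    -2 ([x, y] o alpha(z) + a b [y, z] o alpha(x) - c [x, z] o alpha(y)),
    a multiple of the cyclic sum. *)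
Lemma hom_anti_pre_lie_admissible (F : fieldType) (A : vectType F)
    (gr : 'Z_2 -> {vspace A}) (mul : A -> A -> A) (alpha : 'End(A)) :
  hom_anti_pre_lie_superalgebra gr mul alpha -> hom_lie_admissible gr mul alpha.
Proof.
case=> Hgr [bm ev] eva left cyc; split=> //.
- exact: supercomm_even.
- by move=> i j x y xi yj; apply: supercomm_skew.
move=> i j k x y z xi yj zk.
have [_ evc] := supercomm_even Hgr (conj bm ev).
have [axi ayj azk] := And3 (eva i x xi) (eva j y yj) (eva k z zk).
rewrite (supercommE Hgr bm axi (evc j k y z yj zk)).
rewrite (supercommE Hgr bm (evc i j x y xi yj) azk).
rewrite (supercommE Hgr bm ayj (evc i k x z xi zk)).
have := cyc i j k x y z xi yj zk; have := left j k i y z x yj zk xi.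
have := left i k j x z y xi zk yj; have := left i j k x y z xi yj zk.
(* Brackets are kept only for the ordered pairs (x, y), (y, z) and (x, z), so
   that equal terms become syntactically equal. *)
rewrite (supercomm_skew Hgr bm yj xi) (supercomm_skew Hgr bm zk yj).
rewrite (supercomm_skew Hgr bm zk xi).
have [m Em] := bilinear_structure bm; rewrite {}Em in bm *.
have expand p i' j' u v : u \in gr i' -> v \in gr j' ->
    m p (supercomm gr m u v) = m p (m u v) - (-1) ^+ (i' * j') *: m p (m v u).
  by move=> ui vj; rewrite (supercommE Hgr bm ui vj) linearBr linearZr_LR.
rewrite (expand _ _ _ _ _ xi yj) (expand _ _ _ _ _ yj zk).
rewrite (expand _ _ _ _ _ xi zk).
rewrite !linearNl !linearZl_LR !superspace_signDr.
rewrite (superspace_signC _ j i) (superspace_signC _ k i).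
rewrite (superspace_signC _ k j) [(-1) ^+ ((i + j)%R * k)]superspace_signC.
rewrite superspace_signDr (superspace_signC _ k i) (superspace_signC _ k j).
have := superspace_sign_sqr F (i * j); have := superspace_sign_sqr F (i * k).
have := superspace_sign_sqr F (j * k).
move: ((-1) ^+ (i * j)) ((-1) ^+ (i * k)) ((-1) ^+ (j * k)) => a b c.
move=> c2 b2 a2 Lxyz Lxzy Lyzx cycl; apply: coord_ext => n.
pose cn := congr1 (coord (vbasis fullv) n).
move: (cn _ _ Lxyz) (cn _ _ Lxzy) (cn _ _ Lyzx) (cn _ _ cycl).
rewrite !(linearD, linearN, linearZ) linear0 /=.
move=> /(canRL (subrK _)) E1 /(canRL (subrK _)) E2 /(canRL (subrK _)) E3.
(* Multiplying the cyclic identity by b gives its first term coefficient 1. *)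
move/(congr1 ( *%R b)); rewrite mulr0 -addrA mulrDr mulrA b2 mul1r.
by move/(canRL (addrK _)) => E4; rewrite E1 E2 E3 E4; ring: a2 b2 c2.
Qed.

Lemma superalgebra_hom_supercomm (F : fieldType) (A B : vectType F)
    (grA : 'Z_2 -> {vspace A}) (mulA : A -> A -> A) (alphaA : 'End(A))
    (grB : 'Z_2 -> {vspace B}) (mulB : B -> B -> B) (alphaB : 'End(B))
    (f : 'Hom(A, B)) (i j : 'Z_2) (x y : A) :
  is_grading grA -> is_grading grB ->
  bilinear_for *:%R *:%R mulA -> bilinear_for *:%R *:%R mulB ->
  superalgebra_hom grA mulA alphaA grB mulB alphaB f ->
  x \in grA i -> y \in grA j ->
  f (supercomm grA mulA x y) = supercomm grB mulB (f x) (f y).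
Proof.
move=> HA HB bA bB [ev hm _] xi yj.
rewrite (supercommE HA bA xi yj) (supercommE HB bB (ev i x xi) (ev j y yj)).
by rewrite linearB linearZ /= !hm.
Qed.

(** Each axiom of the target is the image of the same axiom of the source,
    applied to homogeneous preimages. *)
Lemma hom_anti_pre_lie_surjective_image (F : fieldType) (A B : vectType F)
    (grA : 'Z_2 -> {vspace A}) (mulA : A -> A -> A) (alphaA : 'End(A))
    (grB : 'Z_2 -> {vspace B}) (mulB : B -> B -> B) (alphaB : 'End(B))
    (f : 'Hom(A, B)) :
  hom_anti_pre_lie_superalgebra grA mulA alphaA -> is_grading grB ->
  superalgebra_hom grA mulA alphaA grB mulB alphaB f ->
  limg f = fullv -> hom_anti_pre_lie_superalgebra grB mulB alphaB.
Proof.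
case=> HA [bA evA] evalpha left cyc HB hf surj.
have [ev hm /lfunP tw] := hf.
have ftw u : alphaB (f u) = f (alphaA u) by have := tw u; rewrite !comp_lfunE.
have lift x : exists u, x = f u.
  by have /memv_imgP[u _ ->] : x \in limg f; [rewrite surj memvf | exists u].
have hlift i x : x \in grB i -> exists2 u, u \in grA i & x = f u.
  by apply: (homogeneous_preimage HA HB ev); rewrite surj memvf.
have bB : bilinear_for *:%R *:%R mulB.
  have [m Em] := bilinear_structure bA; rewrite {}Em in hm.
  split=> z a x y /=;
    have [[u ->] [v ->] [w ->]] := And3 (lift x) (lift y) (lift z).
    by rewrite -linearP -!hm linearPl linearP.
  by rewrite -linearP -!hm linearPr linearP.
have fsc i j u v := superalgebra_hom_supercomm (i := i) (j := j) (x := u)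
  (y := v) HA HB bA bB hf.
split=> //.
- split=> // i j _ _ /hlift[u ui ->] /hlift[v vj ->].
  by rewrite -hm; apply/ev/evA.
- by move=> i _ /hlift[u ui ->]; rewrite ftw; apply/ev/evalpha.
- move=> i j k _ _ _ /hlift[x xi ->] /hlift[y yj ->] /hlift[z zk ->].
  rewrite -(fsc _ _ _ _ yj xi) !ftw -!hm -!linearZ -linearB /=.
  by rewrite (left i j k).
move=> i j k _ _ _ /hlift[x xi ->] /hlift[y yj ->] /hlift[z zk ->].
rewrite -(fsc _ _ _ _ xi yj) -(fsc _ _ _ _ yj zk) -(fsc _ _ _ _ zk xi).
by rewrite !ftw -!hm -!linearZ -!linearD /= (cyc i j k) ?linear0.
Qed.

(** * The product defined by an anti-super-O-operator *)

Section AntiOOperator.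

Variables (F : fieldType) (g : vectType F) (grg : 'Z_2 -> {vspace g}).
Variables (br : g -> g -> g) (alpha : 'End(g)).
Hypothesis Hg : hom_lie_superalgebra grg br alpha.
Variables (V : vectType F) (grV : 'Z_2 -> {vspace V}).
Variables (rho : 'Hom(g, 'End(V))) (beta : 'End(V)).
Hypothesis Hrho : hom_lie_representation grg br alpha grV rho beta.
Variable T : 'Hom(V, g).
Hypothesis HT : anti_super_O_operator grg br alpha grV rho beta T.

Definition operator_mul (u v : V) : V := - rho (T u) v.

Let HgV : is_grading grV := rep_grading Hrho.
Let Hgg : is_grading grg := hl_grading Hg.
Let evT : even_map grV grg T := aso_even HT.

Lemma operator_mul_bilinear : bilinear_for *:%R *:%R operator_mul.
Proof.
split=> z a x y; rewrite /operator_mul /=.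
  by rewrite !linearP /= add_lfunE scale_lfunE opprD scalerN.
by rewrite linearP opprD scalerN.
Qed.

Lemma operator_mul_even : even_bilinear grV operator_mul.
Proof.
split=> [|i j u v ui vj]; first exact: operator_mul_bilinear.
by rewrite rpredN; apply: (rep_even Hrho) => //; apply: evT.
Qed.

Lemma operator_twist (u : V) : T (beta u) = alpha (T u).
Proof. by have /lfunP/(_ u) := aso_twist HT; rewrite !comp_lfunE. Qed.

(** On homogeneous elements this is a rewriting of the operator equation; both
    sides being bilinear, it holds everywhere. *)
Lemma operator_supercomm (u v : V) :
  T (supercomm grV operator_mul u v) = br (T u) (T v).
Proof.
have bm := operator_mul_bilinear; have [brb _] := hl_even_bilinear Hg.
have [bl br'] := supercomm_bilinear grV bm.
move: u v; apply: (bilinear_ext_homogeneous HgV HgV).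
- by split=> z a x y /=; rewrite ?bl ?br' linearP.
- by split=> z a x y /=; rewrite linearP ?(brb.1 (T z)) ?(brb.2 (T z)).
move=> i j u v ui vj; rewrite (supercommE HgV bm ui vj) (aso_bracket HT ui vj).
by rewrite /operator_mul scalerN opprK addrC.
Qed.

(** The components v_j of v are again killed by T.  Hence v_j o u_i = 0 for
    each component u_i of u, so that u_i o v_j is the supercommutator of u_i
    and v_j, which T sends to [T u_i, 0] = 0. *)
Lemma operator_mul_lker (u v : V) : T v = 0 -> T (operator_mul u v) = 0.
Proof.
move=> Tv0; have [m Em] := bilinear_structure operator_mul_bilinear.
rewrite Em -(sum_component u HgV) -(sum_component v HgV) linear_sumlz linear_sum.
rewrite big1 // => i _; rewrite linear_sumr linear_sum big1 // => j _.
have Tvj0 : T (component grV j v) = 0.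
  by rewrite -(even_map_component _ _ HgV Hgg evT) Tv0 linear0.
have [ui vj] := (component_mem grV i u, component_mem grV j v).
have := operator_supercomm (component grV i u) (component grV j v).
have [b Eb] := bilinear_structure (hl_even_bilinear Hg).1.
rewrite Tvj0 Eb linear0r (supercommE HgV operator_mul_bilinear ui vj) -Em.
by rewrite {2}/operator_mul Tvj0 linear0 lfunE /= oppr0 scaler0 subr0.
Qed.

Lemma operator_mul_supercomm (u v w : V) :
  operator_mul (supercomm grV operator_mul u v) w = - rho (br (T u) (T v)) w.
Proof. by rewrite /operator_mul operator_supercomm. Qed.

(** Both sides are rho([T u, T v]) (beta w): the left one by the representation
    axiom for the bracket, the right one by [operator_mul_supercomm] and
    skew-symmetry. *)
Lemma operator_mul_left (i j : 'Z_2) (u v w : V) :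
  u \in grV i -> v \in grV j ->
  operator_mul (beta u) (operator_mul v w)
  - (-1) ^+ (i * j) *: operator_mul (beta v) (operator_mul u w)
  = (-1) ^+ (i * j) *:
    operator_mul (supercomm grV operator_mul v u) (beta w).
Proof.
move=> ui vj; rewrite operator_mul_supercomm.
have -> : rho (br (T v) (T u)) (beta w) =
    - ((-1) ^+ (i * j) *: rho (br (T u) (T v)) (beta w)).
  rewrite (hl_skew Hg (evT vj) (evT ui)) superspace_signC [rho _]linearN.
  by rewrite linearZ opp_lfunE scale_lfunE.
rewrite opprK scalerA superspace_sign_sqr scale1r.
have /lfunP/(_ w) := rep_bracket Hrho (evT ui) (evT vj).
rewrite add_lfunE opp_lfunE scale_lfunE !comp_lfunE => ->.
rewrite /operator_mul !operator_twist (linearN (rho (alpha (T u)))).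
by rewrite (linearN (rho (alpha (T v)))) !opprK.
Qed.

(** The two cyclic sums weight their terms by different signs, whose ratio is
    the same for all three terms, since (-1)^(ik) has square 1. *)
Lemma operator_mul_cyclic (i j k : 'Z_2) (u v w : V) :
  (-1) ^+ (i * k) *: operator_mul (supercomm grV operator_mul u v) (beta w)
  + (-1) ^+ (i * j) *: operator_mul (supercomm grV operator_mul v w) (beta u)
  + (-1) ^+ (j * k) *: operator_mul (supercomm grV operator_mul w u) (beta v)
  = - (-1) ^+ (i * k) *:
    (rho (br (T u) (T v)) (beta w)
     + (-1) ^+ (i * (j + k)) *: rho (br (T v) (T w)) (beta u)
     + (-1) ^+ (k * (i + j)) *: rho (br (T w) (T u)) (beta v)).
Proof.
rewrite !operator_mul_supercomm !scalerDr !scalerA !mulnDr !exprD.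
rewrite (mulnC k i) (mulnC k j) !scalerN !scaleNr.
have s2 := superspace_sign_sqr F (i * k).
congr (_ + _ + _); rewrite -scaleNr; congr (_ *: _).
  by rewrite mulNr [_ ^+ (i * j) * _]mulrC mulrA s2 mul1r.
by rewrite mulNr mulrA s2 mul1r.
Qed.

Lemma operator_mul_anti_pre_lieP :
  hom_anti_pre_lie_superalgebra grV operator_mul beta <->
  strong br grV rho beta T.
Proof.
split=> [[_ _ _ _ cyc] i j k u v w ui vj wk | sT].
  have /eqP := cyc i j k u v w ui vj wk; rewrite operator_mul_cyclic.
  by rewrite scaler_eq0 oppr_eq0 signr_eq0 => /eqP.
split=> //.
- exact: operator_mul_even.
- exact: rep_even_twist Hrho.
- by move=> i j k u v w ui vj _; apply: operator_mul_left.
by move=> i j k u v w ui vj wk; rewrite operator_mul_cyclic sT // scaler0.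
Qed.

(** * The induced structure on the image *)

Lemma onto_img_surjective : limg (onto_img T) = fullv.
Proof.
apply/eqP; rewrite eqEsubv subvf; apply/subvP=> x _.
have /memv_imgP[u _ xE] := subvsP x; apply/memv_imgP.
exists u; first exact: memvf.
by apply: subvs_inj; rewrite /= onto_imgE.
Qed.

Lemma image_grading : is_grading (sub_grading (limg T) grg).
Proof.
apply: sub_grading_is_grading => // i _ /memv_imgP[u _ ->].
by rewrite (even_map_component _ _ HgV Hgg evT) memv_img ?memvf.
Qed.

(** [(onto_img T)^-1] is some linear section of [onto_img T], in general not an even one;
    by [image_mulE] the product does not depend on it. *)
Definition image_mul (x y : subvs_of (limg T)) : subvs_of (limg T) :=
  onto_img T (operator_mul ((onto_img T)^-1%VF x) ((onto_img T)^-1%VF y)).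

Definition image_twist : 'End(subvs_of (limg T)) :=
  (linfun (vsproj (limg T)) \o alpha \o linfun vsval)%VF.

Lemma onto_img_eq0 (u : V) : (onto_img T u == 0) = (T u == 0).
Proof. by rewrite -val_eqE /= onto_imgE. Qed.

Lemma image_twistE (x : subvs_of (limg T)) :
  vsval (image_twist x) = alpha (vsval x).
Proof.
rewrite /image_twist !comp_lfunE !lfunE /= vsprojK //.
have /memv_imgP[u _ ->] := subvsP x.
by rewrite -operator_twist memv_img ?memvf.
Qed.

(** The product depends on its first factor only through T, by definition, and
    on its second factor only through T by [operator_mul_lker]. *)
Lemma image_mulE (u v : V) :
  image_mul (onto_img T u) (onto_img T v) = onto_img T (operator_mul u v).
Proof.
rewrite /image_mul; set u' := _ (onto_img T u); set v' := _ (onto_img T v).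
have lift w : T ((onto_img T)^-1%VF (onto_img T w)) = T w.
  by rewrite -[LHS]onto_imgE limg_lfunVK ?onto_imgE // memv_img ?memvf.
have -> : operator_mul u' v' = operator_mul u v'.
  by rewrite /operator_mul lift.
have [m Em] := bilinear_structure operator_mul_bilinear.
apply/eqP; rewrite -subr_eq0 -linearB onto_img_eq0 /= Em -linearBr -Em.
by rewrite operator_mul_lker // linearB /= lift subrr.
Qed.

Lemma onto_img_hom :
  superalgebra_hom grV operator_mul beta
    (sub_grading (limg T) grg) image_mul image_twist (onto_img T).
Proof.
split=> [i u ui | u v |]; first by rewrite sub_gradingE onto_imgE evT.
  by rewrite image_mulE.
apply/lfunP=> u; apply: subvs_inj; rewrite [in LHS]comp_lfunE onto_imgE.
by rewrite [in RHS]comp_lfunE image_twistE onto_imgE operator_twist.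
Qed.

End AntiOOperator.

Theorem theorem3p2 (F : fieldType) (charF : [pchar F] =i pred0)
    (g : vectType F) (grg : 'Z_2 -> {vspace g}) (br : g -> g -> g)
    (alpha : 'End(g)) (Hg : hom_lie_superalgebra grg br alpha)
    (V : vectType F) (grV : 'Z_2 -> {vspace V})
    (rho : 'Hom(g, 'End(V))) (beta : 'End(V))
    (Hrho : hom_lie_representation grg br alpha grV rho beta)
    (T : 'Hom(V, g))
    (HT : anti_super_O_operator grg br alpha grV rho beta T) :
  let mulV : V -> V -> V := fun u v => - rho (T u) v in
  [/\ (forall (i j k : 'Z_2) (u v w : V),
         u \in grV i -> v \in grV j -> w \in grV k ->
         mulV (beta u) (mulV v w)
         - (-1) ^+ (i * j) *: mulV (beta v) (mulV u w)
         = (-1) ^+ (i * j) *: mulV (supercomm grV mulV v u) (beta w)),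
      (hom_lie_admissible grV mulV beta
       /\ hom_anti_pre_lie_superalgebra grV mulV beta
       <-> strong br grV rho beta T)
    & (strong br grV rho beta T ->
       superalgebra_hom grV (supercomm grV mulV) beta grg br alpha T
       /\ exists (mulT : subvs_of (limg T) -> subvs_of (limg T) ->
                         subvs_of (limg T))
                 (alphaT : 'End(subvs_of (limg T))),
            [/\ (forall x, vsval (alphaT x) = alpha (vsval x)),
                (forall u v,
                   mulT (onto_img T u) (onto_img T v) = onto_img T (mulV u v)),
                hom_anti_pre_lie_superalgebra
                  (sub_grading (limg T) grg) mulT alphaT
              & superalgebra_hom grV mulV beta
                  (sub_grading (limg T) grg) mulT alphaT (onto_img T)])].
Proof.
move=> mulV; have apl := operator_mul_anti_pre_lieP Hg Hrho HT.
split.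
- by move=> i j k u v w ui vj _; apply: (operator_mul_left Hg Hrho HT w ui vj).
- split=> [[_ /apl] // | /apl sT].
  by split=> //; apply: hom_anti_pre_lie_admissible.
move/apl=> aplV; split.
  split; first exact: aso_even HT.
    by move=> u v; apply: (operator_supercomm Hg Hrho HT).
  exact: aso_twist HT.
have hT := onto_img_hom Hg Hrho HT.
exists (image_mul rho (T := T)), (image_twist alpha T); split=> //.
- exact: (image_twistE HT).
- exact: (image_mulE Hg Hrho HT).
apply: (hom_anti_pre_lie_surjective_image aplV _ hT).
  exact: (image_grading Hg Hrho HT).
exact: onto_img_surjective.
Qed.
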